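(* Let $Z=(A,U)$ be the decision task with $A=[0,1]$ and $U(a,y)=1-(a-y)^2$. There exists an absolute constant $c>0$ such that for every $\varepsilon\in(0,10^{-100})$ and every randomized response function $r:[0,1]\to\Delta([0,1])$, there exists a distribution $\mathcal D$ on $[0,1]\times\{0,1\}$ with $\mathsf{Cutoff}(\mathcal D)=\varepsilon$ and $\mathsf{SR}_Z(r,\mathcal D)\ge c\,\varepsilon^{2/3}$.
   Context: For a distribution $\mathcal D$ of $(p,y)\in[0,1]\times\{0,1\}$, the cutoff calibration error is $\mathsf{Cutoff}(\mathcal D)=\sup_{0\le a\le b\le1}\big|\mathbb E_{(p,y)\sim\mathcal D}[(y-p)\mathbb I[a\le p\le b]]\big|$. For a randomized response function $r:[0,1]\to\Delta(A)$, the swap regret is $\mathsf{SR}_Z(r,\mathcal D)=\sup_{\sigma:A\to A}\mathbb E_{(p,y)\sim\mathcal D,\,a\sim r(p)}[U(\sigma(a),y)-U(a,y)]$. *)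

(* Defs.v *)
From HB Require Import structures.
From mathcomp Require Import all_boot all_order all_algebra.
From mathcomp Require Import all_classical all_reals all_analysis.
Set Implicit Arguments. Unset Strict Implicit. Unset Printing Implicit Defensive.
Import Order.TTheory GRing.Theory Num.Theory.
Local Open Scope classical_set_scope.
Local Open Scope ring_scope.

Section Defs.
Variable R : realType.

Definition U (a : R) (y : bool) : R := 1 - (a - (y%:R : R)) ^+ 2.

Definition cutoff_term (D : probability (R * bool)%type R) (a b : R) : \bar R :=
  (\int[D]_z (((z.2%:R : R) - z.1) * ((a <= z.1) && (z.1 <= b))%:R)%:E)%E.

Definition Cutoff (D : probability (R * bool)%type R) : \bar R :=
  ereal_sup [set x | exists a b : R,
     [/\ 0 <= a, a <= b, b <= 1 & x = `| cutoff_term D a b |%E] ].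

Definition swap_gain (r : R.-pker R ~> R) (D : probability (R * bool)%type R)
    (sigma : R -> R) : \bar R :=
  (\int[D]_z \int[r z.1]_a (U (sigma a) z.2 - U a z.2)%:E)%E.

Definition swap_fun (sigma : R -> R) : Prop :=
  measurable_fun setT sigma /\ (forall a : R, 0 <= a <= 1 -> 0 <= sigma a <= 1).

Definition SR (r : R.-pker R ~> R) (D : probability (R * bool)%type R) : \bar R :=
  ereal_sup [set swap_gain r D sigma | sigma in swap_fun].

End Defs.

(* Main.v *)
(** Write [V p] for the expected squared distance of the action [a ~ r p] from
    [p], and let [e = eps^(1/3)].  If [V p] is at least of order [e^2] for some
    [p], put all the mass at [p] with bias [+eps] or [-eps]; swapping every
    action to [p] then gains about [V p].  Otherwise [r p] stays within distance
    of order [e] of [p], so about [1/e] equally spaced points [p_i] can be told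
    apart by their actions.  Give [p_i] a deterministic outcome [y_i],
    alternating with [i], and a mass making its bias exactly [+eps] or [-eps]:
    interval sums of the biases telescope, so the cutoff error is [eps], whereas
    swapping the actions near [p_i] to [y_i] gains of order [eps] for every [i],
    that is [eps / e = eps^(2/3)] in total. *)

Require Import Defs.
From HB Require Import structures.
From mathcomp Require Import all_boot all_order all_algebra.
From mathcomp Require Import all_classical all_reals all_analysis.
From mathcomp Require Import measurable_realfun ring lra.
Import Order.TTheory GRing.Theory Num.Theory.
Local Open Scope classical_set_scope.
Local Open Scope ring_scope.

(** * Alternating sums of monotone sequences *)

Lemma alternating_sum_bounds (R : realDomainType) n (c : nat -> R) :
  (forall i, 0 <= c i) -> (forall i, c i.+1 <= c i) ->
  0 <= \sum_(i < n) (-1 : R) ^+ i * c i <= c 0%N.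
Proof.
elim: n c => [|n IHn] c c0 cS; first by rewrite big_ord0 lexx c0.
(* Peeling off the first term leaves [c 0] minus the alternating sum of the shifted sequence, which
   lies between 0 and [c 1 <= c 0] by induction. *)
rewrite big_ord_recl expr0 mul1r.
under eq_bigr do rewrite /= /bump /= add1n exprS mulN1r mulNr.
rewrite sumrN.
have /andP[] := IHn (c \o S) (fun i => c0 i.+1) (fun i => cS i.+1).
by have := cS 0%N => /=; lra.
Qed.

(** The indicator of [a <= p i <= b] is that of [p i <= b] minus that of [p i < a]. Both are
    nonincreasing in [i], so each alternating sum lies in [0, 1] and their difference in [-1, 1]. *)
Lemma alternating_interval_sum (R : realDomainType) n (p : nat -> R) (a b : R) :
  (forall i, p i <= p i.+1) -> a <= b ->
  `|\sum_(i < n) (-1 : R) ^+ i * ((a <= p i) && (p i <= b))%:R| <= 1.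
Proof.
move=> pS ab.
have bd (P : nat -> bool) : (forall i, P i.+1 -> P i) ->
    0 <= \sum_(i < n) (-1 : R) ^+ i * (P i)%:R <= 1.
  move=> PS; have c0 i : 0 <= (P i)%:R :> R by rewrite ler0n.
  have cS i : (P i.+1)%:R <= (P i)%:R :> R.
    by rewrite ler_nat; case: (P i.+1) (PS i) => // ->.
  have /andP[/= ge0 le0] := alternating_sum_bounds R n (fun i => (P i)%:R) c0 cS.
  by rewrite ge0 (le_trans le0)// lern1 leq_b1.
have /andP[b0 b1] := bd (fun i => p i <= b) (fun i => le_trans (pS i)).
have /andP[a0 a1] := bd (fun i => p i < a) (fun i => le_lt_trans (pS i)).
rewrite [X in `|X|](_ : _ = \sum_(i < n) (-1 : R) ^+ i * (p i <= b)%R%:R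
   - \sum_(i < n) (-1 : R) ^+ i * (p i < a)%R%:R); first by rewrite ler_norml; lra.
rewrite -sumrB; apply: eq_bigr => i _; rewrite -mulrBr; congr (_ * _).
case: (lerP a (p i)) => [_|pa]; first by rewrite subr0.
by rewrite (le_trans (ltW pa) ab) subrr.
Qed.

(** * Finitely supported distributions *)

Definition atomic_measure {d} {T : measurableType d} {R : realType}
    (w : nat -> {nonneg R}) (z : nat -> T) (n : nat) : {measure set T -> \bar R} :=
  msum (fun i => mscale (w i) (dirac (z i))) n.

(** The nonnegative case is applied to the positive and negative parts; finiteness at the atoms lets
    the two sums be subtracted in the reals. *)
Lemma integral_atomic_measure {d} {T : measurableType d} {R : realType}
    (w : nat -> {nonneg R}) (z : nat -> T) (n : nat) (f : T -> \bar R) :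
  measurable_fun setT f -> (forall i, f (z i) \is a fin_num) ->
  (\int[atomic_measure w z n]_x f x = \sum_(i < n) (w i)%:num%:E * f (z i))%E.
Proof.
move=> mf ffin.
have int_ge0 (g : T -> \bar R) : measurable_fun setT g -> (forall x, 0 <= g x)%E ->
    (\int[atomic_measure w z n]_x g x = \sum_(i < n) (w i)%:num%:E * g (z i))%E.
  move=> mg g0; rewrite /atomic_measure ge0_integral_measure_sum//.
  apply: eq_bigr => i _; rewrite ge0_integral_mscale//.
  by rewrite integral_dirac// diracT mul1e.
have mp := measurable_funepos mf; have mn := measurable_funeneg mf.
rewrite integralE !int_ge0//.
have fp i : (f^\+ (z i) = (fine (f^\+ (z i)))%:E)%E.
  by rewrite fineK// funeposE; case: (f (z i)) (ffin i) => // r _; rewrite -EFin_max.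
have fn i : (f^\- (z i) = (fine (f^\- (z i)))%:E)%E.
  by rewrite fineK// funenegE; case: (f (z i)) (ffin i) => // r _; rewrite -EFin_max.
have sum_fine (g : T -> \bar R) : (forall i, g (z i) = (fine (g (z i)))%:E) ->
    (\sum_(i < n) (w i)%:num%:E * g (z i) =
     (\sum_(i < n) (w i)%:num * fine (g (z i)))%:E)%E.
  by move=> gE; rewrite -sumEFin; apply: eq_bigr => i _; rewrite EFinM -gE.
rewrite !sum_fine//; last by move=> i; rewrite fineK.
rewrite -EFinB -sumrB; congr EFin; apply: eq_bigr => i _; rewrite -mulrBr.
have -> : f (z i) = (f^\+ (z i) - f^\- (z i))%E by rewrite {1}[f]funeposneg.
by rewrite fp fn.
Qed.

(** An alias of [mu] that carries the proof of unit mass, so that a probability structure can be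
    attached to it. *)
Definition unit_mass_measure {d} {T : measurableType d} {R : realType}
  (mu : {measure set T -> \bar R}) (mu1 : mu setT = 1%E) : set T -> \bar R := mu.

HB.instance Definition _ {d} {T : measurableType d} {R : realType}
    (mu : {measure set T -> \bar R}) (mu1 : mu setT = 1%E) :=
  isMeasure.Build _ _ _ (unit_mass_measure mu mu1)
    (measure0 mu) (measure_ge0 mu) (@measure_semi_sigma_additive _ _ _ mu).

HB.instance Definition _ {d} {T : measurableType d} {R : realType}
    (mu : {measure set T -> \bar R}) (mu1 : mu setT = 1%E) :=
  Measure_isProbability.Build _ _ _ (unit_mass_measure mu mu1) mu1.

Lemma atomic_probability {d} {T : measurableType d} {R : realType}
    (w : nat -> {nonneg R}) (z : nat -> T) (n : nat) :
  \sum_(i < n) (w i)%:num = 1 ->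
  exists D : probability T R, forall f : T -> \bar R, measurable_fun setT f ->
    (forall i, f (z i) \is a fin_num) ->
    (\int[D]_x f x = \sum_(i < n) (w i)%:num%:E * f (z i))%E.
Proof.
move=> w1; have mu1 : atomic_measure w z n setT = 1%E.
  rewrite /atomic_measure /= /msum /= /mscale /=.
  under eq_bigr do rewrite diracT mule1.
  by rewrite sumEFin w1.
exists (unit_mass_measure _ mu1) => f mf ffin.
by rewrite -(integral_atomic_measure w z n f mf ffin); apply: eq_measure_integral.
Qed.

(** * Expected gain of a swap at one prediction *)

Lemma measurable_unit_interval (R : realType) : measurable [set a : R | 0 <= a <= 1].
Proof.
by rewrite [X in measurable X](_ : _ = [set` `[0, 1]])//; apply/seteqP; split=> x;
  rewrite /= in_itv.
Qed.

Lemma integral_full_measure {d} {T : measurableType d} {R : realType}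
    (mu : {measure set T -> \bar R}) (A : set T) (f : T -> \bar R) :
  mu setT = 1%E -> measurable A -> mu A = 1%E -> measurable_fun setT f ->
  (\int[mu]_x f x = \int[mu]_(x in A) f x)%E.
Proof.
move=> mu1 mA muA mf; rewrite [RHS]integral_mkcond; apply: ae_eq_integral => //.
  by apply/(measurable_restrictT f mA); exact: measurable_funTS.
exists (~` A); split; first exact: measurableC.
  have : (1 = mu A + mu (~` A))%E.
    by rewrite -mu1 -(setUv A); exact: (measureU mu mA (measurableC mA) (setICr A)).
  rewrite muA; have : (0 <= mu (~` A))%E by [].
  case: (mu (~` A)) => // x; rewrite lee_fin => x0 -[] xe; congr EFin; lra.
move=> x /= H Ax; apply: H => _; by rewrite patchE mem_set.
Qed.

Lemma bounded_integrable {d} {T : measurableType d} {R : realType}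
    (mu : {measure set T -> \bar R}) (A : set T) (f : T -> R) (M : R) :
  measurable A -> (mu A < +oo)%E -> measurable_fun setT f ->
  (forall a, A a -> `|f a| <= M) -> mu.-integrable A (EFin \o f).
Proof.
move=> mA Afin mf fM; apply: measurable_bounded_integrable => //.
  exact: measurable_funTS.
exists M; split; first exact: num_real.
by move=> x Mx y Ay; rewrite /= (le_trans (fM y Ay))// ltW.
Qed.

(** The restriction to [0, 1] keeps the integrand bounded, so that a real-valued integral can
    replace the inner integral of [swap_gain]. *)
Definition expected_gain {R : realType} (r : R.-pker R ~> R) (sigma : R -> R)
    (z : R * bool) : R :=
  \int[r z.1]_(a in [set a : R | 0 <= a <= 1]) (U (sigma a) z.2 - U a z.2).

Lemma measurable_gain {R : realType} (sigma : R -> R) (y : bool) :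
  measurable_fun setT sigma ->
  measurable_fun setT (fun a => U (sigma a) y - U a y).
Proof.
move=> ms; rewrite /U; apply: measurable_funB; apply: measurable_funB => //;
  apply: measurable_funX; exact: measurable_funB.
Qed.

Lemma gain_bounded {R : realType} (a b : R) (y : bool) :
  0 <= a <= 1 -> 0 <= b <= 1 -> `|U b y - U a y| <= 1.
Proof. by move=> ? ?; rewrite /U ler_norml; case: y => /=; nra. Qed.

Lemma expected_gainE {R : realType} (r : R.-pker R ~> R) (sigma : R -> R)
    (z : R * bool) :
  swap_fun sigma -> r z.1 [set a : R | 0 <= a <= 1] = 1%E ->
  (\int[r z.1]_a (U (sigma a) z.2 - U a z.2)%:E = (expected_gain r sigma z)%:E)%E.
Proof.
move=> [ms s01] rI; have mg := measurable_gain sigma z.2 ms.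
rewrite (integral_full_measure _ [set a : R | 0 <= a <= 1])//.
- rewrite /expected_gain /Rintegral fineK//.
  apply: integrable_fin_num; first exact: measurable_unit_interval.
  apply: (bounded_integrable _ _ _ 1) => //; first exact: measurable_unit_interval.
    by rewrite rI ltry.
  by move=> a a01; apply: gain_bounded => //; exact: s01.
- exact: prob_kernel.
- exact: measurable_unit_interval.
- exact/measurable_EFinP.
Qed.

(** For a fixed outcome, the positive and negative parts of the gain integrate to measurable
    functions of the prediction; the two outcomes are then glued together. *)
Lemma measurable_swap_integrand {R : realType} (r : R.-pker R ~> R) (sigma : R -> R) :
  measurable_fun setT sigma ->
  measurable_fun setT (fun z : R * bool =>
    \int[r z.1]_a (U (sigma a) z.2 - U a z.2)%:E)%E.
Proof.
move=> ms.
have mG y : measurable_fun setT (fun p : R =>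
    \int[r p]_a (U (sigma a) y - U a y)%:E)%E.
  have /measurable_EFinP mg := measurable_gain sigma y ms.
  under eq_fun do rewrite integralE.
  by apply: emeasurable_funB; apply: measurable_fun_integral_kernel => //;
    [exact: measurable_kernel | exact: measurable_funepos
    |exact: measurable_kernel | exact: measurable_funeneg].
rewrite (_ : (fun _ => _) = fun z : R * bool =>
    if z.2 then (\int[r z.1]_a (U (sigma a) true - U a true)%:E)%E
    else (\int[r z.1]_a (U (sigma a) false - U a false)%:E)%E).
  exact: (measurable_fun_if_pair (mG true) (mG false)).
by apply/funext => -[p []].
Qed.

(** Reduces both constructions below to finite sums. For the swap regret a lower bound suffices, so
    any single admissible [sigma] can be tested. *)
Lemma atomic_distribution {R : realType} (w : nat -> {nonneg R})
    (z : nat -> R * bool) (n : nat) :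
  \sum_(i < n) (w i)%:num = 1 -> (forall i, 0 <= (z i).1 <= 1) ->
  exists D : probability (R * bool)%type R,
  [/\ D [set z | 0 <= z.1 <= 1] = 1%E,
      forall a b, cutoff_term D a b = (\sum_(i < n) (w i)%:num *
        (((z i).2%:R - (z i).1) * ((a <= (z i).1) && ((z i).1 <= b))%:R))%:E
    & forall r : R.-pker R ~> R,
      (forall p : R, 0 <= p <= 1 -> r p [set a : R | 0 <= a <= 1] = 1%E) ->
      forall sigma, swap_fun sigma ->
      ((\sum_(i < n) (w i)%:num * expected_gain r sigma (z i))%:E <= SR r D)%E].
Proof.
move=> w1 z01; have [D intD] := atomic_probability w z n w1.
have m1 : measurable_fun setT (fst : R * bool -> R) by exact: measurable_fst.
have mS : measurable [set z : R * bool | 0 <= z.1 <= 1].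
  have := m1 measurableT _ (measurable_unit_interval R).
  by rewrite setTI.
exists D; split.
- transitivity (\int[D]_x (\1_[set z : R * bool | 0 <= z.1 <= 1] x)%:E)%E.
    by rewrite integral_indic// setIT.
  rewrite intD//; last exact/measurable_EFinP.
  rewrite -[RHS]/(1%:E) -[in RHS]w1 -sumEFin; apply: eq_bigr => i _.
  by rewrite indicE mem_set ?mule1//=.
- move=> a b; rewrite /cutoff_term intD//.
    by rewrite -sumEFin; apply: eq_bigr => i _.
  apply/measurable_EFinP; apply: measurable_funM.
    apply: measurable_funB => //.
    have mb : measurable_fun setT (fun b : bool => b%:R : R) by [].
    by apply: (measurableT_comp mb); exact: measurable_snd.
  have mb : measurable_fun setT (fun b : bool => b%:R : R) by [].
  apply: (measurableT_comp mb); apply: measurable_and.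
    exact: measurable_fun_ler.
  exact: measurable_fun_ler.
- move=> r r01 sigma ssig; apply: ereal_sup_ubound; exists sigma => //.
  rewrite /swap_gain intD.
  + rewrite -sumEFin; apply: eq_bigr => i _.
    by rewrite expected_gainE// r01.
  + by case: ssig => ms _; exact: measurable_swap_integrand.
  + by move=> i; rewrite expected_gainE// r01.
Qed.

(** * Moments of the action around the prediction; the second one is V p *)

Definition moment {R : realType} (r : R.-pker R ~> R) (p : R) (n : nat) : R :=
  \int[r p]_(a in [set a : R | 0 <= a <= 1]) (a - p) ^+ n.

Lemma integrable_moment {R : realType} (r : R.-pker R ~> R) (p : R) n :
  0 <= p <= 1 -> r p [set a : R | 0 <= a <= 1] = 1%E ->
  (r p).-integrable [set a : R | 0 <= a <= 1] (EFin \o fun a => (a - p) ^+ n).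
Proof.
move=> p01 rI; apply: (bounded_integrable _ _ _ 1).
- exact: measurable_unit_interval.
- by rewrite rI ltry.
- by apply: measurable_funX; exact: measurable_funB.
- by move=> a /= a01; rewrite normrX exprn_ile1// ler_norml; lra.
Qed.

(** Integrates a pointwise quadratic minorant of the gain against the probability [r p]. Every gain
    estimate below thus becomes a polynomial inequality in [a]. *)
Lemma expected_gain_ge {R : realType} (r : R.-pker R ~> R) (sigma : R -> R)
    (p : R) (y : bool) (u v w : R) :
  swap_fun sigma -> 0 <= p <= 1 -> r p [set a : R | 0 <= a <= 1] = 1%E ->
  (forall a, 0 <= a <= 1 ->
    u + v * (a - p) + w * (a - p) ^+ 2 <= U (sigma a) y - U a y) ->
  u + v * moment r p 1 + w * moment r p 2 <= expected_gain r sigma (p, y).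
Proof.
move=> [ms s01] p01 rI H.
have mI := measurable_unit_interval R.
have int n := integrable_moment r p n p01 rI.
have intZ c n : (r p).-integrable [set a : R | 0 <= a <= 1]
    (EFin \o fun a => c * (a - p) ^+ n) := integrableZl mI c (int n).
have -> : u + v * moment r p 1 + w * moment r p 2 =
    \int[r p]_(a in [set a : R | 0 <= a <= 1])
      (u * (a - p) ^+ 0 + v * (a - p) ^+ 1 + w * (a - p) ^+ 2).
  rewrite RintegralD//; last exact: (integrableD mI (intZ u 0%N) (intZ v 1%N)).
  rewrite RintegralD// !RintegralZl//.
  congr (_ + _ + _); rewrite -[LHS]mulr1; congr (_ * _).
  under eq_Rintegral do rewrite expr0.
  by rewrite Rintegral_cst// mul1r /= rI.
apply: le_Rintegral => //.
- have := integrableD mI (integrableD mI (intZ u 0%N) (intZ v 1%N)) (intZ w 2%N).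
  exact.
- apply: (bounded_integrable _ _ _ 1) => //; first by rewrite rI ltry.
    exact: measurable_gain.
  by move=> a a01; apply: gain_bounded => //; exact: s01.
- by move=> a a01; rewrite expr0 mulr1 expr1; exact: H.
Qed.

Lemma moment1_bound {R : realType} (r : R.-pker R ~> R) (p : R) :
  0 <= p <= 1 -> r p [set a : R | 0 <= a <= 1] = 1%E -> `|moment r p 1| <= 1.
Proof.
move=> p01 rI; have mI := measurable_unit_interval R.
have int n := integrable_moment r p n p01 rI.
have intc c : (r p).-integrable [set a : R | 0 <= a <= 1] (EFin \o cst c).
  apply: (bounded_integrable _ _ _ `|c|) => //; by rewrite rI ltry.
have intcE c : \int[r p]_(a in [set a : R | 0 <= a <= 1]) (cst c a) = c.
  by rewrite Rintegral_cst//= rI mulr1.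
rewrite ler_norml -[leLHS]intcE -[X in _ && (_ <= X)]intcE.
by apply/andP; split; apply: le_Rintegral => // a /= ?; rewrite expr1; lra.
Qed.

(** * Swaps acting near separated centres *)

Fixpoint local_swap {R : realType} (c : nat -> R) (y : nat -> bool) (h : R)
    (n : nat) (a : R) : R :=
  if n is m.+1 then
    if `|a - c m| < h then (y m)%:R else local_swap c y h m a
  else a.

Lemma swap_fun_local_swap {R : realType} (c : nat -> R) y (h : R) n :
  swap_fun (local_swap c y h n).
Proof.
split; last first.
  elim: n => //= n IHn a a01; case: ifPn => _; last exact: IHn.
  by case: (y n); rewrite lexx ler01.
elim: n => [|n IHn] /=; first exact: measurable_id.
apply: measurable_fun_ifT => //.
apply: measurable_fun_ltr => //; apply: measurableT_comp => //.
exact: measurable_funB.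
Qed.

(** Two distinct centres within [h] of [a] would be less than [2h] apart, so the order in which
    [local_swap] tests the centres is immaterial. *)
Lemma local_swap_near {R : realType} (c : nat -> R) y (h : R) n i a :
  (forall i j, i != j -> h *+ 2 <= `|c i - c j|) -> (i < n)%N ->
  `|a - c i| < h -> local_swap c y h n a = (y i)%:R.
Proof.
move=> sep + ai; elim: n => //= n IHn.
rewrite ltnS leq_eqVlt => /predU1P[<-|i_n]; first by rewrite ai.
have := sep i n; rewrite ltn_eqF// => /(_ isT) sepin.
case: ifPn => [an|_]; last exact: IHn.
have := le_trans sepin (ler_distD a (c i) (c n)).
by rewrite (distrC (c i) a) mulr2n leNgt ltrD.
Qed.

Lemma local_swap_far {R : realType} (c : nat -> R) y (h : R) n a :
  (forall i, h <= `|a - c i|) -> local_swap c y h n a = a.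
Proof. by move=> far; elim: n => //= n ->; rewrite ltNge far. Qed.

(** * The two families of hard distributions *)

Lemma Cutoff_eq {R : realType} (D : probability (R * bool)%type R) (f : R -> R -> R)
    (eps a0 b0 : R) :
  (forall a b, cutoff_term D a b = (f a b)%:E) ->
  (forall a b, a <= b -> `|f a b| <= eps) ->
  [/\ 0 <= a0, a0 <= b0 & b0 <= 1] -> `|f a0 b0| = eps ->
  Cutoff D = eps%:E.
Proof.
move=> fE f_le [a0_ge0 a0b0 b0_le1] f0; apply/eqP; rewrite eq_le; apply/andP; split.
  apply: ge_ereal_sup => _ [a [b [_ ab _ ->]]].
  by rewrite fE abse_EFin lee_fin f_le.
by apply: ereal_sup_ubound; exists a0, b0; split=> //; rewrite fE abse_EFin f0.
Qed.

(** If outcome 1 has probability [p + s * eps] with [s] a sign, swapping every action to [p] gains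
    exactly [moment r p 2 - 2 * eps * (s * moment r p 1)], and the first moment is at most 1 in
    absolute value. *)
Lemma biased_point_distribution {R : realType} (r : R.-pker R ~> R) (eps p : R) :
  0 < eps -> eps <= 2^-1 -> 0 <= p <= 1 ->
  (forall p : R, 0 <= p <= 1 -> r p [set a : R | 0 <= a <= 1] = 1%E) ->
  exists D : probability (R * bool)%type R,
    [/\ D [set z | 0 <= z.1 <= 1] = 1%E,
        Cutoff D = eps%:E
      & ((moment r p 2 - 2 * eps)%:E <= SR r D)%E].
Proof.
move=> eps0 eps2 p01 r01.
(* The bias points towards the farther endpoint of [0, 1], where there is room for [eps <= 1/2]. *)
have [s [s1 q01]] : exists s : R, `|s| = 1 /\ 0 <= p + s * eps <= 1.
  have [p2|p2] := lerP p 2^-1.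
    by exists 1; rewrite normr1; split=> //; lra.
  by exists (-1); rewrite normrN normr1; split=> //; lra.
set q := p + s * eps in q01.
pose wt (i : nat) := if i == 0%N then q else 1 - q.
have wt0 i : 0 <= wt i by rewrite /wt; case: ifP => _; lra.
pose z (i : nat) := (p, i == 0%N).
have [||D [D1 cD gD]] := atomic_distribution (fun i => NngNum (wt0 i)) z 2.
- by rewrite !big_ord_recr big_ord0 /= /wt /=; ring.
- by [].
exists D; split=> //.
- apply: (Cutoff_eq D (fun a b => s * eps * ((a <= p) && (p <= b))%:R) eps 0 1).
  + move=> a b; rewrite cD !big_ord_recr big_ord0 /= /wt /= /q; congr EFin; ring.
  + move=> a b _; rewrite !normrM s1 mul1r gtr0_norm//.
    by case: (_ && _); rewrite /= ?normr1 ?normr0; lra.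
  + by split; lra.
  + by move/andP: p01 => [-> ->]; rewrite mulr1 normrM s1 mul1r gtr0_norm.
- have ssig : swap_fun (fun _ : R => p) by split.
  apply: (le_trans _ (gD r r01 _ ssig)); rewrite lee_fin.
  rewrite !big_ord_recr big_ord0 /= /wt /z /= add0r.
  have rp := r01 p p01.
  have gain_ge (y : bool) : 2 * (p - y%:R) * moment r p 1 + moment r p 2
      <= expected_gain r (fun _ => p) (p, y).
    have := expected_gain_ge r (fun _ => p) p y 0 (2 * (p - y%:R)) 1 ssig p01 rp.
    rewrite add0r mul1r; apply=> a a01.
    by rewrite /U le_eqVlt; apply/orP; left; apply/eqP; ring.
  have := moment1_bound r p p01 rp; rewrite ler_norml => /andP[m1 m2].
  have sm : s * moment r p 1 <= 1.
    rewrite (le_trans (ler_norm _))// normrM s1 mul1r.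
    exact: moment1_bound.
  have q0 : 0 <= q by lra.
  have q1 : 0 <= 1 - q by lra.
  have := ler_wpM2l q0 (gain_ge true).
  have := ler_wpM2l q1 (gain_ge false).
  have : q * (2 * (p - true%:R) * moment r p 1 + moment r p 2) +
    (1 - q) * (2 * (p - false%:R) * moment r p 1 + moment r p 2)
    = moment r p 2 - 2 * eps * (s * moment r p 1) by rewrite /q /=; ring.
  have : eps * (s * moment r p 1) <= eps * 1 by rewrite ler_pM2l.
  by lra.
Qed.

(* The probability mass not used by the [k] biased points sits at [(0, false)],
   which is unbiased. *)
Lemma alternating_points_distribution {R : realType} (r : R.-pker R ~> R)
    (eps h V : R) (k : nat) :
  0 < eps -> (0 < k)%N -> 4 * k%:R * eps <= 1 -> h <= 8^-1 -> 4 * k%:R * h = 1 ->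
  256 * V <= h ^+ 2 ->
  (forall p : R, 0 <= p <= 1 -> r p [set a : R | 0 <= a <= 1] = 1%E) ->
  (forall p : R, 0 <= p <= 1 -> moment r p 2 <= V) ->
  exists D : probability (R * bool)%type R,
    [/\ D [set z | 0 <= z.1 <= 1] = 1%E,
        Cutoff D = eps%:E
      & ((k%:R * eps / 128 - 64 * V)%:E <= SR r D)%E].
Proof.
move=> eps0 k0 keps h8 kh Vh r01 mV.
have kR0 : 0 < k%:R :> R by rewrite ltr0n.
have h0 : 0 < h by rewrite -(pmulr_rgt0 _ (_ : 0 < 4 * k%:R)) ?kh// mulr_gt0.
(* Since [4 * k * h = 1], the first [k] points lie in [1/4, 3/4], away from both outcomes; the
   spacing [2h] keeps their [h]-neighbourhoods disjoint. *)
pose p (i : nat) : R := 4^-1 + 2 * h * i%:R.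
pose y (i : nat) := ~~ odd i.
have p_ge i : 4^-1 <= p i by rewrite /p lerDl mulr_ge0 ?ler0n// mulr_ge0// ltW.
have p_le i : (i < k)%N -> p i <= 3 / 4.
  move=> ik; have : h * i%:R <= h * k%:R by rewrite ler_pM2l// ler_nat ltnW.
  by rewrite /p; lra.
(* The mass that makes the bias at [p i] equal to [(-1) ^+ i * eps]. It is positive because
   [y i - p i] has the sign of [(-1) ^+ i], and it lies between [eps] and [4 * eps] because that
   difference has size between 1/4 and 3/4. *)
pose m (i : nat) := (-1) ^+ i * eps / ((y i)%:R - p i).
have bias0 i : (i < k)%N -> (y i)%:R - p i != 0.
  move=> /p_le; have := p_ge i; rewrite /y => ? ?; apply/eqP.
  by case: odd => /=; lra.
have m_bias i : (i < k)%N -> m i * ((y i)%:R - p i) = (-1) ^+ i * eps.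
  by move=> ik; rewrite /m divfK// bias0.
have m_bd i : (i < k)%N -> eps <= m i <= 4 * eps.
  move=> ik; have := p_ge i; have := p_le i ik; have := m_bias i ik.
  rewrite -signr_odd /y; case: odd => /=; rewrite ?expr1 ?expr0 => e a b.
    by apply/andP; split; nra.
  by apply/andP; split; nra.
pose M := \sum_(i < k) m i.
have M_le : M <= 1.
  apply: le_trans keps; apply: (@le_trans _ _ (\sum_(i < k) 4 * eps)).
    by apply: ler_sum => i _; case/andP: (m_bd i (ltn_ord i)).
  by rewrite sumr_const card_ord -mulr_natl; lra.
pose wt i := if (i < k)%N then m i else 1 - M.
have wt0 i : 0 <= wt i.
  rewrite /wt; case: ifPn => [ik|_]; last by rewrite subr_ge0.
  by case/andP: (m_bd i ik) => + _; apply: le_trans; exact: ltW.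
pose z (i : nat) := if (i < k)%N then (p i, y i) else (0, false).
have [||D [D1 cD gD]] := atomic_distribution (fun i => NngNum (wt0 i)) z k.+1.
- rewrite big_ord_recr /= {2}/wt ltnn.
  under eq_bigr do rewrite /wt ltn_ord.
  by rewrite -/M; ring.
- move=> i; rewrite /z; case: ifPn => [ik|_] /=; last by rewrite lexx ler01.
  by have := p_le i ik; have := p_ge i; lra.
exists D; split=> //.
(* The degenerate interval at [1/4 = p 0] isolates the first point and so attains [eps]. *)
- apply: (Cutoff_eq D (fun a b => eps *
    \sum_(i < k) (-1) ^+ i * ((a <= p i) && (p i <= b))%:R) eps 4^-1 4^-1).
  + move=> a b; rewrite cD big_ord_recr /= [X in _ + X](_ : _ = 0) ?addr0; last first.
      by rewrite /z ltnn /= subr0 mul0r mulr0.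
    congr EFin; rewrite mulr_sumr; apply: eq_bigr => i _.
    by rewrite /wt /z ltn_ord /= mulrA m_bias//; ring.
  + move=> a b ab; rewrite normrM gtr0_norm// ler_piMr ?(ltW eps0)//.
    apply: alternating_interval_sum => // i.
    by rewrite /p lerD2l ler_pM2l ?ler_nat// mulr_gt0.
  + by split; lra.
  + case: k k0 {kh keps p_le bias0 m_bias m_bd M M_le wt wt0 z D D1 cD gD kR0} => // k _.
    rewrite big_ord_recl big1 => [|i _].
      by rewrite /= /p mulr0 !addr0 lexx expr0 !mulr1 gtr0_norm.
    rewrite [X in _ * (_ X)%:R](_ : _ = false) ?mulr0//.
    apply/negbTE; rewrite negb_and -!ltNge; apply/orP; right.
    by rewrite /p ltrDl mulr_gt0 ?ltr0n// mulr_gt0.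
- pose sig := local_swap p y h k.
  have ssig : swap_fun sig by exact: swap_fun_local_swap.
  have sep i j : i != j -> h *+ 2 <= `|p i - p j|.
    wlog ij : i j / (i < j)%N.
      move=> H; rewrite neq_ltn => /orP[] ij; first by apply: H => //; rewrite ltn_eqF.
      by rewrite distrC; apply: H => //; rewrite ltn_eqF.
    move=> _; rewrite distrC ger0_norm; last first.
      by rewrite /p opprD addrACA subrr add0r -mulrBr mulr_ge0 ?subr_ge0 ?ler_nat ?(ltnW ij)//; lra.
    have : i%:R + 1 <= j%:R :> R by rewrite natr1 ler_nat.
    by move=> /(ler_wpM2l (ltW h0)); rewrite /p -mulr_natl; lra.
  apply: (le_trans _ (gD r r01 _ ssig)); rewrite lee_fin.
  rewrite big_ord_recr /= {2}/wt {2}/z ltnn.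
  (* The minorant is [1/64 - 2 (a - p i)^2 / h^2]. Within [h <= 1/8] of [p i], the action is at
     distance at least 1/8 from [y i], so the swap gains at least 1/64. Farther away the minorant is
     below -1, the worst possible gain. As [V / h^2 <= 1/256], the integral is at least
     [1/64 - 2/256 = 1/128]. *)
  have gain_i (i : 'I_k) : 128^-1 <= expected_gain r sig (z i).
    rewrite /z ltn_ord.
    have := p_le i (ltn_ord i); have := p_ge i => p1 p2.
    have p01 : 0 <= p i <= 1 by lra.
    have := expected_gain_ge r sig (p i) (y i) 64^-1 0 (- (2 / h ^+ 2)) ssig p01 (r01 _ p01).
    rewrite mul0r addr0 => H; apply: le_trans (H _) => [|a a01].
      have : moment r (p i) 2 / h ^+ 2 <= 256^-1.
        rewrite ler_pdivrMr ?exprn_gt0//; have := mV _ p01; lra.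
      lra.
    rewrite mul0r addr0.
    have [ai|ai] := ltrP `|a - p i| h.
      rewrite /sig (local_swap_near _ _ _ _ i)// /U subrr expr0n subr0.
      have : 0 <= 2 / h ^+ 2 * (a - p i) ^+ 2.
        by rewrite mulr_ge0 ?sqr_ge0// divr_ge0// sqr_ge0.
      move: ai; rewrite ltr_norml => /andP[ai1 ai2].
      by rewrite /y; case: odd => /=; nra.
    have := gain_bounded a (sig a) (y i) a01 (ssig.2 a a01).
    rewrite ler_norml => /andP[+ _].
    have : 1 <= (a - p i) ^+ 2 / h ^+ 2.
      rewrite ler_pdivlMr ?exprn_gt0// mul1r -(@real_normK _ (a - p i)) ?num_real//.
      by rewrite lerXn2r ?nnegrE// ltW.
    lra.
  (* The minorant is [- 64 a^2]: actions up to 1/8 are at distance at least [h] from every [p i],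
     hence fixed by the swap, and beyond 1/8 the minorant is below -1. *)
  have gain_0 : - (64 * V) <= expected_gain r sig (0, false).
    have p01 : 0 <= (0 : R) <= 1 by rewrite lexx ler01.
    have := expected_gain_ge r sig 0 false 0 0 (- 64) ssig p01 (r01 _ p01).
    rewrite mul0r !add0r => H; apply: le_trans (H _) => [|a a01].
      by have := mV _ p01; lra.
    rewrite mul0r add0r subr0.
    have [a8|a8] := lerP a 8^-1.
      rewrite /sig local_swap_far ?subrr => [|i].
        by have := sqr_ge0 a; lra.
      rewrite distrC ger0_norm; have := p_ge i; lra.
    have := gain_bounded a (sig a) false a01 (ssig.2 a a01).
    by rewrite ler_norml => /andP[+ _]; nra.
  have V0 : 0 <= V.
    have p01 : 0 <= (0 : R) <= 1 by rewrite lexx ler01.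
    apply: le_trans (mV _ p01); apply: Rintegral_ge0 => a _; exact: sqr_ge0.
  (* Each of the [k] points contributes at least [eps / 128]; the atom at 0 has weight [1 - M <= 1]
     and loses at most [64 * V]. *)
  apply: lerD.
    rewrite -mulrA mulr_natl -[in leLHS](card_ord k) -sumr_const.
    apply: ler_sum => i _; apply: ler_pM => //; first exact: ltW.
    by rewrite /wt ltn_ord; case/andP: (m_bd i (ltn_ord i)).
  have M0 : 0 <= M.
    by apply: sumr_ge0 => i _; have := wt0 i; rewrite /wt ltn_ord.
  nra.
Qed.

(** * Choice of the parameters and the case distinction *)

Theorem theoremB1 (R : realType) :
  exists c : R, 0 < c /\
  forall eps : R, 0 < eps -> eps < ((10 : R) ^+ 100)^-1 ->
  forall r : R.-pker R ~> R,
    (forall p : R, 0 <= p <= 1 -> r p [set a : R | 0 <= a <= 1] = 1%E) ->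
    exists D : probability (R * bool)%type R,
      [/\ D [set z | 0 <= z.1 <= 1] = 1%E,
          Cutoff D = eps%:E
        & ((c * eps `^ (2 / 3))%:E <= SR r D)%E].
Proof.
(* The constant is dictated by the one-point case, which yields [e^2 / 256^2 - 2 * eps] with
   [eps <= 10^-6 e^2]; the other case leaves at least [(1/64 - 1/1024) e^2]. *)
exists (512^-1 ^+ 2); split; first by rewrite exprn_gt0// invr_gt0.
move=> eps eps0 eps_small r r01.
pose e := eps `^ 3^-1.
have e0 : 0 < e by exact: powR_gt0.
have e3 : e ^+ 3 = eps by rewrite -powR_mulrn ?powR_ge0// -powRrM mulVf// powRr1// ltW.
have -> : eps `^ (2 / 3) = e ^+ 2.
  by rewrite -powR_mulrn ?powR_ge0// -powRrM mulrC.
(* Cubing reduces this to [eps < 10^-18], which is all that is used of the bound on [eps]. *)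
have e_small : e < 10^-1 ^+ 6.
  rewrite -(@ltr_pXn2r _ 3)// ?nnegrE ?exprn_ge0 ?invr_ge0 ?(ltW e0)// e3.
  apply: lt_le_trans eps_small _; rewrite -exprM exprVn lef_pV2 ?posrE ?exprn_gt0//.
  by rewrite ler_eXn2l// ltr1n.
have {e_small eps_small}e_small : e < 10^-1 * 10^-1 * 10^-1 * 10^-1 * 10^-1 * 10^-1.
  by rewrite (lt_le_trans e_small)// !exprSr expr0 mul1r.
have eps_e2 : eps <= 10^-1 * 10^-1 * 10^-1 * 10^-1 * 10^-1 * 10^-1 * e ^+ 2.
  by rewrite -e3 exprS ler_pM2r ?exprn_gt0//; lra.
have e2_e : e ^+ 2 <= e by rewrite expr2 ler_piMr ?ltW//; lra.
(* With the threshold [V = (e / 256)^2], the requirement [256 * V <= h^2] reads [e / 16 <= h]. *)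
have [[p [p01 Vp]]|small] := pselect (exists p, 0 <= p <= 1 /\ (256^-1 * e) ^+ 2 < moment r p 2).
  have [|D [D1 DC DS]] := biased_point_distribution r eps p eps0 _ p01 r01; first by lra.
  exists D; split=> //; apply: le_trans DS; rewrite lee_fin.
  by move: Vp; rewrite exprMn; lra.
(* Truncation gives [2 <= k * e <= 4], so [h = 1 / (4k)] lies between [e / 16] and [e / 8], and
   [k * eps = (k * e) * e^2] is at least [2 * e^2]. *)
pose k := Num.truncn (4 / e).
have /andP[k_le k_gt] : k%:R <= 4 / e < k.+1%:R by apply: truncn_itv; rewrite divr_ge0// ltW.
have ke_le : k%:R * e <= 4 by rewrite -ler_pdivlMr.
have ke_ge : 2 <= k%:R * e.
  by move: k_gt; rewrite -[k.+1%:R]natr1 ltr_pdivrMr// mulrDl mul1r; lra.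
have kR0 : 0 < k%:R :> R by rewrite -(pmulr_lgt0 _ e0); lra.
pose h : R := (4 * k%:R)^-1.
have kh : 4 * k%:R * h = 1 by rewrite divff// mulf_neq0// gt_eqF.
have h0 : 0 < h by rewrite invr_gt0 mulr_gt0.
have h_ge : 16^-1 * e <= h by nra.
have h_le : 8 * h <= e by nra.
have ke3 : k%:R * eps = (k%:R * e) * e ^+ 2 by rewrite -e3 exprS mulrA.
have [||||p p01|D [D1 DC DS]] :=
  @alternating_points_distribution R r eps h ((256^-1 * e) ^+ 2) k eps0 _ _ _ kh _ r01 _.
- by rewrite -(ltr0n R).
- by rewrite -mulrA ke3; have := ler_wpM2r (sqr_ge0 e) ke_le; lra.
- by lra.
- have : (16^-1 * e) ^+ 2 <= h ^+ 2 by rewrite lerXn2r ?nnegrE// ?mulr_ge0 ?ltW.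
  by rewrite !exprMn; lra.
- by rewrite leNgt; apply/negP => Vp; apply: small; exists p.
exists D; split=> //; apply: le_trans DS; rewrite lee_fin ke3.
have := ler_wpM2r (sqr_ge0 e) ke_ge; rewrite !exprMn; have := sqr_ge0 e; lra.
Qed.
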